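(* Let $\gamma>0$, let $g=\min_{i\in I}g_i\colon X\to(-\infty,+\infty]$ be a min-convex function, and let $T_{\rm PPA}:=\operatorname{prox}_{\gamma g}$. Suppose that $x^*\in\mathbf{Fix}\,T_{\rm PPA}$. Denote $r:=r(x^*;T_{\rm PPA})\in(0,+\infty]$ and consider a sequence $(x_n)_{n\in\mathbb{N}}$ satisfying $x_{n+1}\in T_{\rm PPA}(x_n)$ for all $n\in\mathbb{N}$, with $x_0\in\operatorname{int}\mathbb{B}(x^*;r)$. Then $(x_n)_{n\in\mathbb{N}}$ converges to a local minimum of $g$.
   Context: $X$ is a real finite-dimensional Hilbert space with norm $\|\cdot\|$. A function $g\colon X\to(-\infty,+\infty]$ is min-convex if $g=\min_{i\in I}g_i$ pointwise, where $I$ is a finite index set and each $g_i\colon X\to(-\infty,+\infty]$ is proper, lower semicontinuous and convex; such a representation is fixed. The Moreau envelope is ${}^{\gamma}h(x):=\inf_{y\in X}\left(h(y)+\frac{1}{2\gamma}\|x-y\|^2\right)$ and the proximity operator is $\operatorname{prox}_{\gamma h}(x):=\{y\in X:h(y)+\frac{1}{2\gamma}\|x-y\|^2={}^{\gamma}h(x)\}$. One has the representation $\operatorname{prox}_{\gamma g}(x)=\{\operatorname{prox}_{\gamma g_i}(x):i\in\varphi(x)\}$ with $\varphi(x):=\{i\in I:{}^{\gamma}g(x)={}^{\gamma}g_i(x)\}$, and the radius of attraction with respect to it is $r(x^*;T_{\rm PPA}):=\sup\{\delta>0:\forall x\in\mathbb{B}(x^*;\delta),\ \varphi(x)\subseteq\varphi(x^*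 )\}$, which always lies in $(0,+\infty]$. $\mathbb{B}(x;\delta)$ is the closed ball of center $x$ and radius $\delta$ (all of $X$ if $\delta=+\infty$). $\mathbf{Fix}\,T:=\{x:T(x)=\{x\}\}$. A local minimum of a function is a point where the function is finite and which minimizes it over some ball around the point. *)

(* Defs.v *)
From HB Require Import structures.
From mathcomp Require Import all_boot all_order all_algebra.
From mathcomp Require Export sesquilinear.
From mathcomp Require Import all_classical all_reals all_analysis.
Import Order.TTheory GRing.Theory Num.Theory.
Import numFieldNormedType.Exports.

Set Implicit Arguments.
Unset Strict Implicit.
Unset Printing Implicit Defensive.

Local Open Scope classical_set_scope.
Local Open Scope ring_scope.

(* Finite-dimensional real Hilbert spaces: the norm of the normed module is the
   one induced by the inner product, finite dimension comes from [Vector], and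
   completeness is then automatic. *)
HB.mixin Record isFinDimHilbert (R : realType) X
    of NormedModule R X & Vector R X := {
  inner : {dot X for idfun} ;
  sqr_normE : forall x : X, `|x| ^+ 2 = inner x x
}.

#[short(type="finDimHilbertType")]
HB.structure Definition FinDimHilbert (R : realType) :=
  { X of isFinDimHilbert R X & NormedModule R X & Vector R X }.

Section Defs.
Context {R : realType} {X : finDimHilbertType R}.
Local Open Scope ereal_scope.

Implicit Types (f g h : X -> \bar R) (x y : X).

Definition proper_fun f := (forall x, -oo < f x) /\ (exists x, f x < +oo).

(* Only meaningful for functions that do not take the value -oo. *)
Definition econvex f := forall x y (t : R), (0 < t < 1)%R ->
  f (t *: x + (1 - t) *: y)%R <= t%:E * f x + (1 - t)%:E * f y.

Record min_convex (I : finType) (g_ : I -> X -> \bar R) g : Prop := MinConvex {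
  min_convex_index : (0 < #|I|)%N ;
  min_convex_proper : forall i, proper_fun (g_ i) ;
  min_convex_lsc : forall i, lower_semicontinuous (g_ i) ;
  min_convex_convex : forall i, econvex (g_ i) ;
  min_convexE : forall x, g x = \big[Order.min/+oo]_(i : I) g_ i x
}.

Definition prox_obj (gamma : R) h x y : \bar R :=
  h y + ((2 * gamma)^-1 * `|x - y| ^+ 2)%:E.

Definition moreau_env (gamma : R) h x : \bar R :=
  ereal_inf [set prox_obj gamma h x y | y in [set: X]].

Definition prox (gamma : R) h x : set X :=
  [set y | prox_obj gamma h x y = moreau_env gamma h x].

Definition active (gamma : R) (I : finType) (g_ : I -> X -> \bar R) g x :
    set I :=
  [set i | moreau_env gamma g x = moreau_env gamma (g_ i) x].

(* Unlike the library's [closed_ball], this allows an infinite radius. *)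
Definition ecball x (d : \bar R) : set X := [set y | `|x - y|%:E <= d].

Definition attraction_radius (I : Type) (phi : X -> set I) x : \bar R :=
  ereal_sup [set d | 0 < d /\ forall y, ecball x d y -> phi y `<=` phi x].

Definition Fix (T : X -> set X) : set X := [set x | T x = [set x]].

Definition local_minimum f x :=
  f x \is a fin_num /\
  exists2 e : R, (0 < e)%R & forall y, ecball x e%:E y -> f x <= f y.

End Defs.

(* Main.v *)
Require Import Defs.
From HB Require Import structures.
From mathcomp Require Import all_boot all_order all_algebra.
From mathcomp Require Import all_classical all_reals all_analysis.
From mathcomp Require Import ring lra.
Import Order.TTheory GRing.Theory Num.Theory.
Import numFieldNormedType.Exports passmx.

Set Implicit Arguments.
Unset Strict Implicit.
Unset Printing Implicit Defensive.

Local Open Scope classical_set_scope.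
Local Open Scope ring_scope.

(** Write [g = min_i g_i].  Two facts carry the theorem.

    A point [x] with [prox gamma g x x] is always a local minimum of [g]
    ([prox_self_local_minimum]).  Indeed, a piece [g_i] with [g_i x = g x] has
    [x] as a proximal point of itself, hence [x] minimizes the convex function
    [g_i] globally; a piece with [g_i x > g x] stays above [g x] near [x] by
    lower semicontinuity; and there are finitely many pieces.  Moreover the
    limit of the sequence, once it exists, is such a point
    ([prox_min_convex_closed]), so it is enough to prove that the sequence
    converges.

    For convergence, a piece active at [xstar] is minimized at [xstar]
    ([active_fixed_minimizer]).  When [x_0 <> xstar], the distance from [x_0]
    to [xstar] is strictly less than the radius of attraction, so only such
    pieces are active at a point no farther from [xstar] than [x_0].  A proximal
    step from [x] to [p] for a convex function [f] satisfies, for each minimizer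
    [z] of [f], [|x - p|^2 + |p - z|^2 <= |x - z|^2] ([prox_fejer]).  Taking
    [z := xstar], no iterate is farther from [xstar] than [x_0], and they are produced by finitely many
    convex functions with the common minimizer [xstar], used in an arbitrary
    order.  Such iterates converge ([common_minimizer_iterates_cvg]): the step
    lengths tend to 0 and, the space being finite dimensional, there is a
    cluster point [y].  A short step taken near [y] can only come from a
    function that [y] minimizes ([near_prox_minimizer]), and by the inequality
    above with [z := y] it does not increase the distance to [y].  So once the
    iterates come close to [y], they remain so. *)

(** * Cluster points of bounded sequences *)

Section FiniteDimension.
Context {R : realType} {X : finDimHilbertType R}.
Let e := vbasis {:X}.
Let e_basis : basis_of fullv e := vbasisP _.
Implicit Types (x y : X) (u : X ^nat).

(** The inner product enters the development only through this identity, which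
    is the exact strong convexity of the squared norm. *)
Lemma sqr_norm_conv x y (t : R) :
  `|t *: x + (1 - t) *: y| ^+ 2 =
  t * `|x| ^+ 2 + (1 - t) * `|y| ^+ 2 - t * (1 - t) * `|x - y| ^+ 2.
Proof.
have innerC : inner x y = inner y x by rewrite hermC expr0 mul1r.
rewrite !sqr_normE !linearDl !linearDr /= !linearZl_LR !linearZr_LR /=.
have scaleE (a b : R) : a *: (b : R^o) = a * b by [].
rewrite !linearNl !linearNr !scaleE /= innerC.
by ring.
Qed.

Lemma continuous_vecof : continuous (vecof e : 'rV[R]_(\dim {:X}) -> X).
Proof.
move=> v; apply: (@cvg_big X _ +%R 0 xpredT (@add_continuous X) _ (nbhs v)) => i _.
apply: cvgZr_tmp.
exact: coord_continuous.
Qed.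

(** The topology of [X] is not given by coordinates.  That bounded sets have
    bounded coordinates comes from minimizing the continuous positive function
    [|vecof e v|] over the compact unit sphere of the coordinate space, and
    rescaling. *)
Lemma vecof_lower_bound :
  exists2 m : R, 0 < m & forall v : 'rV[R]_(\dim {:X}), m * `|v| <= `|vecof e v : X|.
Proof.
pose S := [set v : 'rV[R]_(\dim {:X}) | `|v| = 1].
have cS : compact S.
  apply: bounded_closed_compact.
    exists 1; split=> // M M1 v /= ->; exact: ltW.
  apply: (closed_comp (f := fun v : 'rV[R]_(\dim {:X}) => `|v|) (D := [set 1])).
    by move=> v _; exact: norm_continuous.
  exact: closed_eq.
(* The sphere is empty when the space is trivial. *)
have [S0|/set0P S0] := eqVneq S set0.
  exists 1 => // v.
  suff -> : v = 0 by rewrite linear0 !normr0 mulr0.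
  apply: contrapT => /eqP v0.
  suff : S (`|v|^-1 *: v) by rewrite S0.
  by rewrite /S/= normrZ normfV normr_id mulVf // normr_eq0.
have [c /set_mem Sc min_c] := @EVT_min_rV R _ (fun v => `|vecof e v : X|) S S0 cS
  (continuous_subspaceT (fun v => cvg_norm (@continuous_vecof v))).
exists `|vecof e c : X|.
  rewrite normr_gt0; apply/eqP => c0.
  have : c = 0 by apply/eqP; rewrite -(vecof_eq0 e_basis) c0.
  by move=> c0'; move: Sc; rewrite /S/= c0' normr0 => /eqP; rewrite eq_sym oner_eq0.
move=> v; have [->|v0] := eqVneq v 0; first by rewrite linear0 !normr0 mulr0.
have nv : 0 < `|v| by rewrite normr_gt0.
have : S (`|v|^-1 *: v).
  by rewrite /S/= normrZ normfV normr_id mulVf // normr_eq0.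
move=> /mem_set /min_c; rewrite linearZ normrZ normfV normr_id mulrC.
by rewrite ler_pdivlMr.
Qed.

(** Compactness of closed balls of the coordinate space, transported to [X]
    along the basis. *)
Lemma bounded_cluster_point u (M : R) : (forall n, `|u n| <= M) ->
  exists y, forall eps : R, 0 < eps -> forall N, exists2 n, (N <= n)%N & `|y - u n| < eps.
Proof.
move=> uM; have [m m0 vecof_ge] := vecof_lower_bound.
pose B := [set v : 'rV[R]_(\dim {:X}) | `|v| <= M / m].
have cB : compact B.
  apply: bounded_closed_compact.
    exists (M / m); split=> [|K MK v /= /le_trans]; [exact: num_real|apply; exact: ltW].
  apply: (closed_comp (f := fun v : 'rV[R]_(\dim {:X}) => `|v|)
    (D := [set r | r <= M / m])).
    by move=> v _; exact: norm_continuous.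
  exact: closed_le.
have Bu n : B (rVof e (u n)).
  rewrite /B /= ler_pdivlMr // mulrC; apply: le_trans (vecof_ge _) _.
  by rewrite (rVofK e_basis).
have [|v [_ vcl]] := cB ((rVof e \o u) @ \oo) _.
  by exists 0%N => // n _; exact: Bu.
exists (vecof e v) => eps eps0 N.
have [|_ [[n Nn <-] /=]] := vcl ((rVof e \o u) @` [set n | (N <= n)%N])
   (vecof e @^-1` ball (vecof e v) eps) _ (continuous_vecof (nbhsx_ballx _ _ eps0)).
  by exists N => // n Nn; exists n.
by rewrite -ball_normE /ball_/= (rVofK e_basis); exists n.
Qed.

End FiniteDimension.

(** * Proximal points of a convex function *)

Section Proximity.
Context {R : realType} {X : finDimHilbertType R}.
Variable gamma : R.
Hypothesis gamma_gt0 : 0 < gamma.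
Local Notation c := ((2 * gamma)^-1).
Local Open Scope ereal_scope.
Implicit Types (f : X -> \bar R) (x y z p : X).

Definition minimizer f x := forall y, f x <= f y.

Let c_gt0 : (0 < c)%R. Proof. by rewrite invr_gt0 mulr_gt0. Qed.

Lemma proxP f x p :
  prox gamma f x p <-> forall y, prox_obj gamma f x p <= prox_obj gamma f x y.
Proof.
split=> [pp y|le_p].
  by rewrite [leLHS]pp; apply: ereal_inf_lbound; exists y.
apply/eqP; rewrite eq_le; apply/andP; split.
  by apply: le_ereal_inf_tmp => _ [y _ <-].
by apply: ereal_inf_lbound; exists p.
Qed.

Lemma prox_fin_num f x p :
  proper_fun f -> prox gamma f x p -> f p \is a fin_num.
Proof.
move=> [fNy [y fy]] /proxP/(_ y); rewrite /prox_obj fin_numE => le_p.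
rewrite gt_eqF ?fNy//=; apply/eqP => fp.
move: le_p; rewrite fp addye// leye_eq => /eqP.
by case: (f y) fy.
Qed.

Lemma lt_EFin_between (a : R) (b : \bar R) :
  a%:E < b -> exists2 d : R, (a < d)%R & d%:E < b.
Proof.
case: b => [b| |]//; last by exists (a + 1)%R; rewrite ?ltrDl ?ltry.
by rewrite lte_fin => ab; exists ((a + b) / 2)%R; rewrite ?lte_fin; lra.
Qed.

Lemma lower_semicontinuousD f (h : X -> R) : (forall x, -oo < f x) ->
  lower_semicontinuous f -> continuous h ->
  lower_semicontinuous (fun x => f x + (h x)%:E).
Proof.
move=> fNy lsc_f cont_h x a afh.
have : (a - h x)%:E < f x by rewrite EFinB lteBlDr.
move=> /lt_EFin_between[b ab /lsc_f[V Vx Vb]].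
exists (V `&` [set y | a - b < h y]%R) => [|y [/Vb by_ /= aby]].
  by apply: filterI => //; apply: (cvgr_gt (h x) (cont_h x)); lra.
by rewrite -[a](subrK b) addrC EFinD lteD.
Qed.

Lemma prox_obj_lsc f x : (forall x, -oo < f x) -> lower_semicontinuous f ->
  lower_semicontinuous (prox_obj gamma f x).
Proof.
move=> fNy lsc_f; apply: lower_semicontinuousD => // y.
apply: cvgMr; apply: (@cvg_comp _ _ _ (fun y => `|x - y|%R) (fun r => r ^+ 2)%R).
  by apply: cvg_norm; apply: cvgB; [exact: cvg_cst|exact: cvg_id].
exact: exprn_continuous.
Qed.

(** The quadratic term contributes all of the strong convexity, by
    [sqr_norm_conv] applied to [x - y] and [x - z]. *)
Lemma prox_obj_strongly_convex f x y z (t : R) : econvex f -> (0 < t < 1)%R ->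
  prox_obj gamma f x (t *: y + (1 - t) *: z)%R +
    (c * (t * (1 - t) * `|y - z| ^+ 2))%:E <=
  t%:E * prox_obj gamma f x y + (1 - t)%:E * prox_obj gamma f x z.
Proof.
move=> cvx_f t01; have [t0 t1] := andP t01.
have -> : prox_obj gamma f x (t *: y + (1 - t) *: z)%R +
    (c * (t * (1 - t) * `|y - z| ^+ 2))%:E = f (t *: y + (1 - t) *: z)%R +
    (t * (c * `|x - y| ^+ 2) + (1 - t) * (c * `|x - z| ^+ 2))%:E.
  rewrite /prox_obj -addeA -EFinD; congr (_ + _%:E).
  have -> : (x - (t *: y + (1 - t) *: z) = t *: (x - y) + (1 - t) *: (x - z))%R.
    by rewrite !scalerBr addrACA -scalerDl [(t + _)%R]addrC subrK scale1r -opprD.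
  have -> : (`|y - z| = `|(x - y) - (x - z)|)%R.
    by rewrite distrC opprB [in RHS]addrC addrA subrK.
  by rewrite sqr_norm_conv; ring.
rewrite /prox_obj !muleDr ?fin_num_adde_defl// -!EFinM EFinD addeACA.
by rewrite leeD2r// cvx_f.
Qed.

(** The objective grows at least quadratically around its minimizer [p]:
    compare the value at [p] with the value at [t *: z + (1 - t) *: p], use
    strong convexity, divide by [t] and let [t] tend to 0. *)
Lemma prox_quadratic_growth f x p z : proper_fun f -> econvex f ->
  prox gamma f x p ->
  prox_obj gamma f x p + (c * `|p - z| ^+ 2)%:E <= prox_obj gamma f x z.
Proof.
move=> pf cvx_f pp.
have fp := prox_fin_num pf pp.
move/proxP in pp.
have [pfNy _] := pf.
have := @prox_obj_strongly_convex f x z p ^~ cvx_f.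
rewrite (distrC z p).
set d := (`|p - z| ^+ 2)%R.
have : 0 <= d%:E by rewrite lee_fin exprn_ge0.
rewrite lee_fin => d0.
have : -oo < prox_obj gamma f x z.
  by rewrite /prox_obj; case: (f z) (pfNy z) => // r _; exact: ltNyr.
have : prox_obj gamma f x p \is a fin_num by rewrite /prox_obj fin_numD fp.
case: (prox_obj gamma f x p) pp => // P pp _.
case: (prox_obj gamma f x z) => // [Z _|_ _]; last by rewrite leey.
move=> sc; rewrite -EFinD lee_fin leNgt; apply/negP => lt_Z.
pose K := (P + c * d - Z)%R.
have cd0 : (0 <= c * d)%R by rewrite mulr_ge0// ltW.
have K0 : (0 < K)%R by rewrite subr_gt0.
(* Were the inequality to fail by [K], any [t] in ]0, 1[ with
   [t * (c * d) < K] would contradict minimality of [p]. *)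
pose t := (K / (K + c * d + 1))%R.
have D0 : (0 < K + c * d + 1)%R by lra.
have t0 : (0 < t)%R by rewrite divr_gt0.
have t1 : (t < 1)%R by rewrite ltr_pdivrMr//; lra.
have /sc : (0 < t < 1)%R by rewrite t0.
have := pp (t *: z + (1 - t) *: p)%R.
case: (prox_obj _ _ _ _) => // W.
rewrite -!EFinM -!EFinD !lee_fin => PW WZ.
have : (t * K <= t * (t * (c * d)))%R by rewrite /K; lra.
rewrite ler_pM2l//.
have tE : (t * (K + c * d + 1) = K)%R by rewrite divfK// gt_eqF.
have tK : (0 < t * K)%R by rewrite mulr_gt0.
by lra.
Qed.

Lemma prox_fixed_minimizer f x : proper_fun f -> econvex f ->
  prox gamma f x x -> minimizer f x.
Proof.
move=> pf cvx_f pp z; have := prox_quadratic_growth z pf cvx_f pp.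
rewrite /prox_obj subrr normr0 expr0n mulr0 adde0.
by rewrite leeD2rE.
Qed.

(** Quadratic growth at [z], combined with [f z <= f p]. *)
Lemma prox_fejer f x p z : proper_fun f -> econvex f ->
  prox gamma f x p -> minimizer f z ->
  (`|x - p| ^+ 2 + `|p - z| ^+ 2 <= `|x - z| ^+ 2)%R.
Proof.
move=> pf cvx_f pp /(_ p) min_z.
have fp := prox_fin_num pf pp.
have := prox_quadratic_growth z pf cvx_f pp.
have [/(_ z) + _] := pf.
rewrite /prox_obj; case: (f p) fp min_z => // P _; case: (f z) => // Z.
rewrite -!EFinD !lee_fin => ZP _ h.
have : (c * (`|x - p| ^+ 2 + `|p - z| ^+ 2) <= c * `|x - z| ^+ 2)%R by lra.
by rewrite ler_pM2l.
Qed.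

(** A minimizing sequence is bounded because, by strong convexity, two points
    with almost minimal value are close to each other.  A cluster point is a minimizer by lower semicontinuity. *)
Lemma prox_nonempty f x : proper_fun f -> lower_semicontinuous f -> econvex f ->
  moreau_env gamma f x \is a fin_num -> prox gamma f x !=set0.
Proof.
move=> pf lsc_f cvx_f env_fin; have [fNy _] := pf.
set E := fine (moreau_env gamma f x).
have envE : moreau_env gamma f x = E%:E by rewrite fineK.
have E_le y : E%:E <= prox_obj gamma f x y.
  by rewrite -envE; apply: ereal_inf_lbound; exists y.
have obj_near n : exists y, prox_obj gamma f x y < (E + n.+1%:R^-1)%:E.
  have := @lb_ereal_inf_adherent R _ n.+1%:R^-1%R _ env_fin.
  case=> [|_ [y _ <-]]; first by rewrite invr_gt0.
  by rewrite -/(moreau_env gamma f x) envE -EFinD; exists y.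
have [u uE] := choice obj_near.
have u_bounded n : (`|u n| <= `|u 0%N| + (4 / c + 1))%R.
  have n1 : (n.+1%:R^-1 <= 1 :> R)%R by rewrite invf_le1// ler1n.
  (* Evaluate the objective at the midpoint of [u n] and [u 0]. *)
  have half01 : (0 < (2^-1 : R) < 1)%R by apply/andP; split; lra.
  have := @prox_obj_strongly_convex f x (u n) (u 0%N) (2^-1)%R cvx_f half01.
  have := E_le (2^-1 *: u n + (1 - 2^-1) *: u 0%N)%R.
  have := E_le (u n); have := E_le (u 0%N).
  have := uE n; have := uE 0%N; rewrite invr1.
  case: (prox_obj gamma f x (u n)) => // a.
  case: (prox_obj gamma f x (u 0%N)) => // b.
  case: (prox_obj _ _ _ _) => // w.
  rewrite !lte_fin !lee_fin => bE aE _ _ Ew cc.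
  have : (c * `|u n - u 0%N| ^+ 2 <= 4)%R.
    have a_le : (a < E + 1)%R by apply: lt_le_trans aE _; rewrite lerD2l.
    move: cc; rewrite (_ : c * _ = 4^-1 * (c * `|u n - u 0%N| ^+ 2))%R.
      by move: (c * _)%R => D; lra.
    by field; rewrite gt_eqF.
  rewrite -ler_pdivlMl// => d2.
  have : (`|u n - u 0%N| <= 4 / c + 1)%R.
    rewrite mulrC in d2; set d := `|_|%R in d2 *; set k := (4 / c)%R in d2 *.
    by nra.
  by have := ler_normD (u n - u 0%N)%R (u 0%N); rewrite subrK; lra.
have [p p_cluster] := bounded_cluster_point u_bounded.
exists p; apply/proxP => y; apply: le_trans (E_le y).
rewrite leNgt; apply/negP => /lt_EFin_between[a Ea].
move=> /(prox_obj_lsc fNy lsc_f)[V /nbhs_ballP[eps /= eps0 ballV] Va].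
have [N _ NE] : \forall n \near \oo, (n.+1%:R^-1 < a - E)%R.
  have aE : (0 < a - E)%R by rewrite subr_gt0.
  exact: near_infty_natSinv_lt (PosNum aE).
have [n Nn un] := p_cluster _ eps0 N.
have /Va : V (u n) by apply: ballV; rewrite -ball_normE.
apply/negP; rewrite -leNgt; apply: le_trans (ltW (uE n)) _.
by rewrite lee_fin -lerBrDl ltW//; exact: NE.
Qed.

End Proximity.

(** * Proximal iterations with a common minimizer *)

Section Iterates.
Context {R : realType} {X : finDimHilbertType R}.
Variable gamma : R.
Hypothesis gamma_gt0 : 0 < gamma.
Local Notation c := ((2 * gamma)^-1).
Implicit Types (f : X -> \bar R) (x y z p : X).

(** If [y] is not a minimizer, some [z] has [f z < f y].  By quadratic growth,
    a proximal point [p] of [u] satisfies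
    [f p <= f z + c * (|u - z|^2 - |p - z|^2)], whose right-hand side is close
    to [f z] when [u] and [p] are both close to [y], whereas lower
    semicontinuity keeps [f p] close to or above [f y]. *)
Lemma near_prox_minimizer f y : proper_fun f -> lower_semicontinuous f ->
  econvex f ->
  \forall q \near (y, y), prox gamma f q.1 q.2 -> minimizer f y.
Proof.
move=> pf lsc_f cvx_f; have [fNy _] := pf.
have [min_y|] := pselect (minimizer f y); first by near=> q.
move=> /existsNP[z /negP]; rewrite -ltNge => zy.
have [Z fz] : exists Z, f z = Z%:E.
  by move: zy (fNy z); case: (f z) => [Z| |]//; [exists Z|rewrite ltNge leey].
rewrite fz in zy; have [a Za ay] := lt_EFin_between zy.
have [V Vy Va] := lsc_f _ _ ay.
pose h (q : X * X) : R := Z + c * (`|q.1 - z| ^+ 2 - `|q.2 - z| ^+ 2).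
have h_cvg : h q @[q --> (y, y)] --> Z.
  have -> : Z = h (y, y) by rewrite /h subrr mulr0 addr0.
  apply: cvgD; first exact: cvg_cst.
  apply: cvgMr; apply: cvgB; apply: (@cvg_comp _ _ _ _ (fun r => r ^+ 2)).
  - by apply: cvg_norm; apply: cvgB; [exact: cvg_fst|exact: cvg_cst].
  - exact: exprn_continuous.
  - by apply: cvg_norm; apply: cvgB; [exact: cvg_snd|exact: cvg_cst].
  - exact: exprn_continuous.
near=> q => pq; exfalso.
have /Va : V q.2 by near: q; exact: cvg_snd.
have : h q < a by near: q; exact: (cvgr_lt Z h_cvg _ Za).
have fq := prox_fin_num pf pq.
have := prox_quadratic_growth gamma_gt0 z pf cvx_f pq.
rewrite /prox_obj /h fz; case: (f q.2) fq => // P _.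
rewrite -!EFinD !lee_fin lte_fin.
have : 0 <= c * `|q.1 - q.2| ^+ 2.
  by rewrite mulr_ge0 ?exprn_ge0// invr_ge0 mulr_ge0// ltW.
move: (c * `|q.1 - q.2| ^+ 2) => d; rewrite mulrBr.
by lra.
Unshelve. all: by end_near. Qed.

(** Each step lowers the squared distance to the common minimizer by at least
    its own squared length, so the step lengths tend to 0.  Near a cluster point [y] and
    for late steps, [near_prox_minimizer] lets only functions minimized at [y]
    act, whatever the order of use; these do not increase the distance to [y],
    which is arbitrarily small at some late time. *)
Lemma common_minimizer_iterates_cvg (I : finType) (f : I -> X -> \bar R)
    (x : X ^nat) z :
  (forall i, proper_fun (f i)) -> (forall i, lower_semicontinuous (f i)) ->
  (forall i, econvex (f i)) ->
  (forall n, exists2 i, minimizer (f i) z & prox gamma (f i) (x n) (x n.+1)) ->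
  exists y, x @ \oo --> y.
Proof.
move=> pf lsc_f cvx_f step.
have fejer_z n : `|x n - x n.+1| ^+ 2 + `|x n.+1 - z| ^+ 2 <= `|x n - z| ^+ 2.
  by have [i min_z p] := step n; exact: (prox_fejer gamma_gt0 (pf i)).
have dist_dec : nonincreasing_seq (fun n => `|x n - z| ^+ 2).
  apply/nonincreasing_seqP => n; apply: le_trans (fejer_z n).
  by rewrite lerDr exprn_ge0.
have x_bounded n : `|x n| <= `|x 0%N - z| + `|z|.
  rewrite -{1}[x n](subrK z); apply: le_trans (ler_normD _ _) _.
  by rewrite lerD2r -ler_sqr ?nnegrE//; exact: dist_dec.
have [y y_cluster] := bounded_cluster_point x_bounded.
exists y.
have steps_cvg0 : (x n - x n.+1) @[n --> \oo] --> (0 : X).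
  apply/norm_cvg0P.
  have dist_cvg : cvgn (fun n => `|x n - z| ^+ 2).
    apply: nonincreasing_is_cvgn => //.
    by exists 0 => _ [n _ <-]; rewrite exprn_ge0.
  have sq_cvg0 : `|x n - x n.+1| ^+ 2 @[n --> \oo] --> (0 : R).
    apply: (@squeeze_cvgr _ _ _ _ (cst 0)
      (fun n => `|x n - z| ^+ 2 - `|x n.+1 - z| ^+ 2)).
    - by near=> n; rewrite exprn_ge0//= lerBrDr fejer_z.
    - exact: cvg_cst.
    - rewrite -(subrr (limn (fun n => `|x n - z| ^+ 2))).
      by apply: cvgB => //; rewrite (cvg_shiftS (fun n => `|x n - z| ^+ 2)).
  apply/cvgr0Pnorm_lt => eps eps0; near=> n.
  rewrite normr_id -(ltr_pXn2r (n := 2)) ?nnegrE ?(ltW eps0)//.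
  by near: n; exact: (cvgr_lt 0 sq_cvg0 _ (exprn_gt0 2 eps0)).
have : \forall q \near (y, y), forall i, prox gamma (f i) q.1 q.2 -> minimizer (f i) y.
  by apply: (@filter_forall _ _ _ (nbhs (y, y))) => i; exact: near_prox_minimizer.
move=> /nbhs_ballP[d /= d0 near_y].
have d20 : 0 < d / 2 by rewrite divr_gt0.
have [N _ small_step] := cvgr0_norm_lt _ steps_cvg0 _ d20.
have fejer_y n : (N <= n)%N -> `|y - x n| < d / 2 -> `|y - x n.+1| <= `|y - x n|.
  move=> Nn yn; have [i _ p] := step n.
  have /near_y/(_ _ p) min_y : ball (y, y) d (x n, x n.+1).
    split=> /=; rewrite -ball_normE /ball_/=.
      by lra.
    have := ler_normD (y - x n) (x n - x n.+1); rewrite addrA subrK.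
    by have := small_step n Nn; rewrite /=; lra.
  have := prox_fejer gamma_gt0 (pf i) (cvx_f i) p min_y.
  rewrite !(distrC y) -(ler_sqr (x := `|x n.+1 - y|)) ?nnegrE//.
  by have := exprn_ge0 2 (normr_ge0 (x n - x n.+1)); lra.
apply/cvgrPdist_lt => eps eps0.
have [n0 Nn0 yn0] : exists2 n, (N <= n)%N & `|y - x n| < Num.min eps (d / 2).
  by apply: y_cluster; rewrite lt_min eps0.
exists n0 => // n /= n0n.
suff : `|y - x n| < Num.min eps (d / 2) by rewrite lt_min => /andP[].
rewrite -(subnKC n0n); elim: (n - n0)%N => [|k ih]; first by rewrite addn0.
rewrite addnS; apply: (le_lt_trans _ ih); apply: fejer_y.
  exact: leq_trans Nn0 (leq_addr _ _).
by move: ih; rewrite lt_min => /andP[].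
Unshelve. all: by end_near. Qed.

End Iterates.

(** * Min-convex functions *)

Section MinConvex.
Context {R : realType} {X : finDimHilbertType R}.
Variables (gamma : R) (I : finType) (g_ : I -> X -> \bar R) (g : X -> \bar R).
Hypothesis gamma_gt0 : 0 < gamma.
Hypothesis mcg : min_convex g_ g.
Local Open Scope ereal_scope.
Implicit Types (x y p : X) (i : I).

Lemma min_convex_le x i : g x <= g_ i x.
Proof. by rewrite (min_convexE mcg) bigmin_le. Qed.

Lemma min_convex_attained x : exists i, g x = g_ i x.
Proof.
have /card_gt0P[i0 _] := min_convex_index mcg.
rewrite (min_convexE mcg) (@bigmin_eq_arg _ _ _ _ i0)//; last by move=> *; exact: leey.
by eexists.
Qed.

Lemma min_convex_proper_fun : proper_fun g.
Proof.
split=> [x|].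
  by have [i ->] := min_convex_attained x; have [] := min_convex_proper mcg i.
have /card_gt0P[i _] := min_convex_index mcg.
have [_ [y giy]] := min_convex_proper mcg i.
by exists y; exact: le_lt_trans (min_convex_le y i) giy.
Qed.

Lemma min_convex_lower_semicontinuous : lower_semicontinuous g.
Proof.
move=> x a ax; have : \forall y \near x, forall i, a%:E < g_ i y.
  apply: filter_forall => i.
  have /(min_convex_lsc mcg)[V Vx Va] := lt_le_trans ax (min_convex_le x i).
  exact: filterS Vx.
move=> near_x; exists (fun y => forall i, a%:E < g_ i y) => // y ay.
by have [i ->] := min_convex_attained y.
Qed.

Lemma prox_obj_le x y i : prox_obj gamma g x y <= prox_obj gamma (g_ i) x y.
Proof. by rewrite leeD2r// min_convex_le. Qed.

(** A proximal point [p] of [g] is a proximal point of any piece that attains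
    the minimum at [p], and that piece has the same envelope as [g] at [x]. *)
Lemma prox_min_convexE x :
  prox gamma g x = \bigcup_(i in active gamma g_ g x) prox gamma (g_ i) x.
Proof.
apply/seteqP; split=> [p pp|p [i act_i pp]]; last first.
  apply/proxP => y; apply: le_trans (prox_obj_le x p i) _.
  by rewrite [leLHS]pp -act_i; apply: ereal_inf_lbound; exists y.
have [i gi] := min_convex_attained p.
have obj_i : prox_obj gamma (g_ i) x p = prox_obj gamma g x p.
  by rewrite /prox_obj gi.
have pp_i : prox gamma (g_ i) x p.
  apply/proxP => y; rewrite obj_i; apply: le_trans (prox_obj_le x y i).
  by move/proxP : pp.
by exists i => //; rewrite /active/= -pp -obj_i.
Qed.

(** Near [x], pieces above [g x] at [x] stay above it by lower semicontinuity;
    the others have [x] as a global minimizer. *)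
Lemma prox_self_local_minimum x : prox gamma g x x -> local_minimum g x.
Proof.
move=> pp; have gx := prox_fin_num min_convex_proper_fun pp.
split => //.
have : \forall y \near x, forall i, g x <= g_ i y.
  apply: filter_forall => i.
  have [gix|] := leP (g_ i x) (g x).
    have gixE : g x = g_ i x by apply/eqP; rewrite eq_le min_convex_le.
    near=> y; rewrite gixE.
    apply: (prox_fixed_minimizer gamma_gt0 (min_convex_proper mcg i)
      (min_convex_convex mcg i)).
    apply/proxP => z; apply: le_trans (prox_obj_le x z i).
    by move/proxP : pp => /(_ z); rewrite /prox_obj gixE.
  rewrite -(fineK gx) => /(min_convex_lsc mcg)[V Vx Va].
  by apply: filterS Vx => y /Va /ltW.
move=> /nbhs_ballP[e /= e0 ball_e]; exists (e / 2)%R; first by rewrite divr_gt0.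
move=> y; rewrite /ecball/= lee_fin => xy.
have [i ->] := min_convex_attained y; apply: ball_e.
by rewrite -ball_normE /ball_/=; lra.
Unshelve. all: by end_near. Qed.

(** Passing to the limit in the inequality that defines
    [prox gamma g (x n) (x n.+1)], with lower semicontinuity on the left and
    continuity of the squared norm on the right.  The quadratic term of the
    left-hand side is only used through its sign. *)
Lemma prox_min_convex_closed (x : X ^nat) xbar :
  (forall n, prox gamma g (x n) (x n.+1)) -> x @ \oo --> xbar ->
  prox gamma g xbar xbar.
Proof.
move=> step x_cvg; apply/proxP => y.
rewrite /prox_obj subrr normr0 expr0n mulr0 adde0 leNgt; apply/negP.
have [gNy _] := min_convex_proper_fun.
have [->|gy] := eqVneq (g y) +oo; first by rewrite addye// ltNge leey.
have [Y gyE] : exists Y, g y = Y%:E.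
  by move: gy (gNy y); case: (g y) => [Y| |]//; exists Y.
rewrite gyE -EFinD => /lt_EFin_between[a lt_a].
move=> /min_convex_lower_semicontinuous[V Vx Va].
pose h n : R := (Y + (2 * gamma)^-1 * `|x n - y| ^+ 2)%R.
have h_cvg : h @ \oo --> (Y + (2 * gamma)^-1 * `|xbar - y| ^+ 2)%R.
  apply: cvgD; first exact: cvg_cst.
  apply: cvgMr; apply: (@cvg_comp _ _ _ _ (fun r => r ^+ 2)%R).
    exact: cvg_norm (cvgB x_cvg (cvg_cst y)).
  exact: exprn_continuous.
have x_cvgS : x n.+1 @[n --> \oo] --> xbar by rewrite (cvg_shiftS x).
near \oo => n.
have ax : a%:E < g (x n.+1).
  by apply: Va; near: n; exact: x_cvgS.
have ha : (h n < a)%R by near: n; exact: (cvgr_lt _ h_cvg _ lt_a).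
have /proxP/(_ y) := step n.
rewrite /prox_obj gyE -EFinD leNgt => /negP; apply.
apply: (@lt_trans _ _ a%:E); first by rewrite lte_fin.
rewrite -[ltLHS]adde0; apply: lte_leD => //.
by rewrite lee_fin mulr_ge0 ?exprn_ge0// invr_ge0 mulr_ge0// ltW.
Unshelve. all: by end_near. Qed.

(** The envelope of an active piece is attained, and by [prox_min_convexE] its
    minimizer is a proximal point of [g] at [x], hence [x] itself. *)
Lemma active_fixed_minimizer x i : Fix (prox gamma g) x ->
  active gamma g_ g x i -> minimizer (g_ i) x.
Proof.
move=> fix_x act_i.
have pp : prox gamma g x x by rewrite [prox _ _ _]fix_x.
have env_fin : moreau_env gamma (g_ i) x \is a fin_num.
  rewrite -act_i -pp /prox_obj fin_numD andbT.
  exact: prox_fin_num min_convex_proper_fun pp.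
have [p pi] := prox_nonempty gamma_gt0 (min_convex_proper mcg i)
  (@min_convex_lsc _ _ _ _ _ mcg i) (min_convex_convex mcg i) env_fin.
have : prox gamma g x p by rewrite prox_min_convexE; exists i.
rewrite [prox _ _ _]fix_x => /= px; rewrite px in pi.
exact: (prox_fixed_minimizer gamma_gt0 (min_convex_proper mcg i)
      (min_convex_convex mcg i)).
Qed.

End MinConvex.

(** * The radius of attraction *)

Section Radius.
Context {R : realType} {X : finDimHilbertType R}.
Implicit Types (x y : X).

(** Push [y] slightly farther from [x] along the ray from [x] through [y].
    The two points have to be distinct: in the trivial space every set
    containing the center is open. *)
Lemma interior_ecball x y (r : \bar R) :
  (ecball x r)° y -> x != y -> (`|x - y|%:E < r)%E.
Proof.
rewrite /interior/= => /nbhs_ballP[e /= e0 ball_r] xy.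
have d0 : 0 < `|x - y| by rewrite normr_gt0 subr_eq0.
pose t := e / 2 / `|x - y|.
have t0 : 0 < t by rewrite !divr_gt0.
have : ecball x r (y - t *: (x - y)).
  apply: ball_r; rewrite -ball_normE /ball_/= opprB addrC subrK normrZ gtr0_norm//.
  by rewrite /t divfK ?gt_eqF//; lra.
rewrite /ecball/= opprB addrCA addrC -{1}[x - y]scale1r -scalerDl.
rewrite normrZ gtr0_norm ?addr_gt0//; apply: lt_le_trans.
by rewrite lte_fin ltr_pMl// ltrDl.
Qed.

Lemma attraction_radius_sub (J : Type) (phi : X -> set J) x y z :
  (`|x - y|%:E < attraction_radius phi x)%E -> `|x - z| <= `|x - y| ->
  phi z `<=` phi x.
Proof.
move=> /ereal_sup_gt[d [_ sub_d] yd] zy; apply: sub_d.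
by rewrite /ecball/=; apply: le_trans (ltW yd); rewrite lee_fin.
Qed.

End Radius.

Theorem theorem6p3 (R : realType) (X : finDimHilbertType R) (gamma : R)
    (I : finType) (g_ : I -> X -> \bar R) (g : X -> \bar R)
    (xstar : X) (x_ : nat -> X) :
  0 < gamma ->
  min_convex g_ g ->
  Fix (prox gamma g) xstar ->
  (forall n, prox gamma g (x_ n) (x_ n.+1)) ->
  (ecball xstar (attraction_radius (active gamma g_ g) xstar))° (x_ 0%N) ->
  exists2 xbar : X, x_ @ \oo --> xbar & local_minimum g xbar.
Proof.
move=> gamma_gt0 mcg fix_xstar step x0_int.
suff [xbar x_cvg] : exists xbar : X, x_ @ \oo --> xbar.
  exists xbar => //; apply: (prox_self_local_minimum gamma_gt0 mcg).
  exact: (prox_min_convex_closed gamma_gt0 mcg step).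
(* Started at [xstar], the sequence is constant since [prox gamma g xstar] is a
   singleton; this case has no strict inequality from [interior_ecball]. *)
have [x0E|x0_neq] := eqVneq xstar (x_ 0%N).
  exists xstar; rewrite (_ : x_ = cst xstar); first exact: cvg_cst.
  apply/funext; elim=> [|n xn]; first exact/esym.
  by have := step n; rewrite xn [prox _ _ _]fix_xstar.
have x0_lt := interior_ecball x0_int x0_neq.
have step_near n : `|xstar - x_ n| <= `|xstar - x_ 0%N| ->
  exists2 i, minimizer (g_ i) xstar & prox gamma (g_ i) (x_ n) (x_ n.+1).
  move=> xn_le; have := step n; rewrite (prox_min_convexE _ mcg) => -[i act_i p].
  exists i => //; apply: (active_fixed_minimizer gamma_gt0 mcg fix_xstar).
  exact: attraction_radius_sub x0_lt xn_le _ act_i.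
have near_xstar n : `|xstar - x_ n| <= `|xstar - x_ 0%N|.
  elim: n => // n xn_le; apply: (le_trans _ xn_le).
  have [i min_i p] := step_near n xn_le.
  have := prox_fejer gamma_gt0 (min_convex_proper mcg i)
    (min_convex_convex mcg i) p min_i.
  rewrite !(distrC xstar) -(ler_sqr (x := `|x_ n.+1 - xstar|)) ?nnegrE//.
  by have := exprn_ge0 2 (normr_ge0 (x_ n - x_ n.+1)); lra.
apply: (common_minimizer_iterates_cvg gamma_gt0 (f := g_) (z := xstar)).
- exact: min_convex_proper mcg.
- exact: min_convex_lsc mcg.
- exact: min_convex_convex mcg.
- by move=> n; exact/step_near/near_xstar.
Qed.
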